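(* Let $G$ be a finitely generated group that is not hyperbolic. Then for every finite generating set $S$ of $G$ and every real number $\lambda' > 54$, the set of $(\lambda',0)$-quasigeodesic words over $S\cup S^{-1}$ (i.e. the $(\lambda',0)$-quasigeodesics in $\Gamma(G,S)$) is not a regular language.
   Context: For a group $G$ with finite generating set $S$, $\Gamma(G,S)$ denotes the Cayley graph: vertices are the elements of $G$ and edges are $\{g,gs\}$ with $g\in G$, $s\in S$. $d_G$ denotes the associated word metric on $G$ (the restriction of the graph metric to vertices). A metric space is $\delta$-hyperbolic (for $\delta\ge 1$) if every geodesic triangle in it is $\delta$-thin, i.e. each side is contained in the $\delta$-neighbourhood of the union of the other two sides; a metric space is hyperbolic if it is $\delta$-hyperbolic for some $\delta$. A finitely generated group $G$ is hyperbolic if $\Gamma(G,S)$ (with its path metric, each edge having length 1) is $\delta$-hyperbolic for some $\delta$ and some finite generating set $S$. Each word over the alphabet $S\cup S^{-1}$ labels a simplicial path in $\Gamma(G,S)$ starting at the identity $e$. For $\lambda\ge1$, $\epsilon\ge0$, a finite word $w$ over $S\cup S^{-1}$ is a $(\lambda,\epsilon)$-quasigeodesic word if every (contiguous) subword $u$ of $w$ satisfies $\mathrm{length}(u)\le \lambda\, d_G(e,u)+\epsilon$, where in $d_G(e,u)$ the word $u$ is identified with the element of $G$ it represents. Equivalently, the simplicial path $c:[0,a]\to\Gamma(G,S)$ labelled by $w$ satisfies $|x-y|\le\lambda d_G(c(x),c(y))+\epsilon$ for all integers $x,y\in[0,a]$. A language over a finite alphabet $A$ is a subset of the free monoid $A^\star$;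 it is regular if it is the set of words accepted by some finite state automaton over $A$ (a finite directed graph with edges labelled by elements of $A$, one initial vertex and a set of final vertices; a word is accepted if it labels a directed path from the initial vertex to a final vertex). *)

(* Defs.v *)
From HB Require Import structures.
From mathcomp Require Import all_boot all_order all_algebra finmap.
From mathcomp Require Import all_classical all_reals.
From mathcomp Require Import lra.

Set Implicit Arguments.
Unset Strict Implicit.
Unset Printing Implicit Defensive.

Import Order.TTheory GRing.Theory Num.Theory.

Local Open Scope classical_set_scope.
Local Open Scope ring_scope.

Record automaton (A : finType) := Automaton {
  state : finType;
  edge : state -> A -> state -> bool;
  initial : state;
  final : {set state} }.

Fixpoint accepts_from (A : finType) (M : automaton A) (q : state M)
    (w : seq A) : Prop :=
  if w is a :: w' then exists2 q', edge q a q' & accepts_from q' w'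
  else q \in final M.

Definition accepts (A : finType) (M : automaton A) (w : seq A) : Prop :=
  accepts_from (initial M) w.

Definition regular (A : finType) (L : set (seq A)) : Prop :=
  exists M : automaton A, L = [set w | accepts M w].

(** Letters are elements of the group, not formal symbols: if [t = s^-1] in the
    group, then the inverse letter of [s] is the letter [t]. *)
Definition letters (G : groupType) (S : {fset G}) : {fset G} :=
  (S `|` [fset s^-1%g | s in S])%fset.

Definition word_val (G : groupType) (S : {fset G}) (w : seq (letters S)) : G :=
  (\big[*%g/1]_(a <- w) val a)%g.

Definition generates (G : groupType) (S : {fset G}) : Prop :=
  forall g : G, exists w : seq (letters S), word_val w = g.

Definition finitely_generated (G : groupType) : Prop :=
  exists S : {fset G}, generates S.

Definition has_word_of_size (G : groupType) (S : {fset G}) (g : G) : pred nat :=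
  fun n => `[< exists2 w : seq (letters S), size w = n & word_val w = g >].

(** The default value [0] is only used when no word represents [g^-1 * h],
    which cannot happen if [S] generates. *)
Definition word_dist (G : groupType) (S : {fset G}) (g h : G) : nat :=
  if pselect (exists n, has_word_of_size S (g^-1 * h)%g n) is left ex
  then ex_minn ex else 0%N.

Definition quasigeodesic_word (R : realType) (G : groupType) (S : {fset G})
    (lambda epsilon : R) (w : seq (letters S)) : Prop :=
  forall u : seq (letters S), infix u w ->
    (size u)%:R <= lambda * (word_dist S 1%g (word_val u))%:R + epsilon.

(** Metric spaces are presented by a carrier and a distance function. *)

Definition geodesic (R : realType) (X : Type) (d : X -> X -> R) (x y : X)
    (A : set X) : Prop :=
  exists (l : R) (c : R -> X),
    [/\ 0 <= l, c 0 = x, c l = y,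
        forall s t, 0 <= s <= l -> 0 <= t <= l -> d (c s) (c t) = `|s - t|
      & A = c @` [set t | 0 <= t <= l]].

Definition within_nbhd (R : realType) (X : Type) (d : X -> X -> R) (delta : R)
    (A B : set X) : Prop :=
  forall x, A x -> exists2 y, B y & d x y <= delta.

Definition delta_hyperbolic (R : realType) (X : Type) (d : X -> X -> R)
    (delta : R) : Prop :=
  forall (x y z : X) (A B C : set X),
    geodesic d x y A -> geodesic d y z B -> geodesic d z x C ->
    [/\ within_nbhd d delta A (B `|` C),
        within_nbhd d delta B (C `|` A)
      & within_nbhd d delta C (A `|` B)].

(** A point of the geometric realization is given by its barycentric
    coordinates: [edge_pt g h t] is the point at distance [t] from [g] on the
    edge from [g] to [h].  As edges are the sets [{g, g * s}], no two of them
    have the same endpoints, and [s = 1] contributes no more than the vertex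
    [g], which is [edge_pt g g t] for every [t]. *)
Definition edge_pt (R : realType) (G : groupType) (g h : G) (t : R) : G -> R :=
  fun k => (1 - t) *+ (k == g) + t *+ (k == h).

Definition vertex (R : realType) (G : groupType) (g : G) : G -> R :=
  fun k => (k == g)%:R.

Definition in_cayley_graph (R : realType) (G : groupType) (S : {fset G})
    (x : G -> R) : Prop :=
  (exists g, x = vertex R g) \/
  (exists g s t, [/\ s \in S, 0 <= t <= 1 & x = edge_pt g (g * s)%g t]).

Definition cayley_graph (R : realType) (G : groupType) (S : {fset G}) : Type :=
  {x : G -> R | in_cayley_graph S x}.

(** [path_length S x y l]: some piecewise linear path of length [l], obtained
    by concatenating finitely many subsegments of edges, joins [x] to [y]. *)
Inductive path_length (R : realType) (G : groupType) (S : {fset G}) :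
    (G -> R) -> (G -> R) -> R -> Prop :=
| path_length_nil x : path_length S x x 0
| path_length_cons g s t u y l :
    s \in S -> 0 <= t <= 1 -> 0 <= u <= 1 ->
    path_length S (edge_pt g (g * s)%g u) y l ->
    path_length S (edge_pt g (g * s)%g t) y (`|t - u| + l).

(** The path metric.  The set of lengths is nonempty when [S] generates. *)
Definition cayley_dist (R : realType) (G : groupType) (S : {fset G})
    (x y : cayley_graph R S) : R :=
  inf [set l | path_length S (sval x) (sval y) l].

Definition hyperbolic_group (R : realType) (G : groupType) : Prop :=
  exists (S : {fset G}) (delta : R),
    [/\ generates S, 1 <= delta & delta_hyperbolic (@cayley_dist R G S) delta].

Lemma word_dist_ex (G : groupType) (S : {fset G}) (g h : G) : generates S ->
  exists2 w : seq (letters S),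
    size w = word_dist S g h & word_val w = (g^-1 * h)%g.
Proof.
move=> /(_ (g^-1 * h)%g)[w0 w0E]; rewrite /word_dist; case: pselect => [ex|nex].
  by case: ex_minnP => n /asboolP[w wn wE] _; exists w.
by exfalso; apply: nex; exists (size w0); apply/asboolP; exists w0.
Qed.

Lemma word_dist_le (G : groupType) (S : {fset G}) (g h : G)
    (w : seq (letters S)) :
  word_val w = (g^-1 * h)%g -> (word_dist S g h <= size w)%N.
Proof.
move=> wE; rewrite /word_dist; case: pselect => [ex|//].
by case: ex_minnP => n _; apply; apply/asboolP; exists w.
Qed.

Lemma word_val_cons (G : groupType) (S : {fset G}) (a : letters S)
    (w : seq (letters S)) : word_val (a :: w) = (val a * word_val w)%g.
Proof. by rewrite /word_val big_cons. Qed.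

Lemma word_dist_letter (G : groupType) (S : {fset G}) (g h s : G) :
  generates S -> s \in letters S ->
  (word_dist S g h <= (word_dist S (g * s)%g h).+1)%N.
Proof.
move=> gS sS; have [w <- wE] := word_dist_ex (g * s)%g h gS.
rewrite -[(size w).+1]/(size ([` sS]%fset :: w)); apply: word_dist_le.
by rewrite word_val_cons wE /= invgM !mulgA mulgV mul1g.
Qed.

Lemma edge_pt0 (R : realType) (G : groupType) (g h : G) :
  edge_pt g h 0 = vertex R g.
Proof. by apply/funext => k; rewrite /edge_pt subr0 mul0rn addr0. Qed.

Lemma edge_pt1 (R : realType) (G : groupType) (g h : G) :
  edge_pt g h 1 = vertex R h.
Proof. by apply/funext => k; rewrite /edge_pt subrr mul0rn add0r. Qed.

Lemma path_length_word (R : realType) (G : groupType) (S : {fset G}) (g : G)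
    (w : seq (letters S)) :
  path_length S (vertex R g) (vertex R (g * word_val w)%g) (size w)%:R.
Proof.
elim: w g => [|a w IH] g; first by rewrite /word_val big_nil mulg1; constructor.
rewrite word_val_cons mulgA [size _]/= -natr1 addrC.
have := valP a; rewrite inE => /orP[aS|/imfsetP[/= s sS aE]].
  rewrite -(edge_pt0 R g (g * val a)%g).
  have -> : 1 + (size w)%:R = `|0 - 1| + (size w)%:R :> R.
    by rewrite sub0r normrN normr1.
  apply: path_length_cons; rewrite ?lexx ?ler01 //.
  by rewrite edge_pt1; apply: IH.
have gE : g = (g * val a * s)%g by rewrite [val a]aE -mulgA mulVg mulg1.
rewrite {1}gE -(edge_pt1 R (g * val a)%g (g * val a * s)%g).
have -> : 1 + (size w)%:R = `|1 - 0| + (size w)%:R :> R by rewrite subr0 normr1.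
apply: path_length_cons; rewrite ?lexx ?ler01 //.
by rewrite edge_pt0; apply: IH.
Qed.

Lemma edge_pt_sum (R : realType) (G : groupType) (f : G -> R) (r : seq G)
    (a b : G) (t : R) : uniq r -> a \in r -> b \in r ->
  \sum_(k <- r) edge_pt a b t k * f k = (1 - t) * f a + t * f b.
Proof.
move=> ur ar br; rewrite /edge_pt.
have dE c x : c \in r -> \sum_(k <- r) (x *+ (k == c)) * f k = x * f c.
  move=> cr; rewrite (bigD1_seq c) //= eqxx big1 ?addr0 // => k /negbTE->.
  by rewrite mul0r.
by rewrite -!dE // -big_split /=; apply: eq_bigr => k _; rewrite mulrDl.
Qed.

Lemma path_length_word_dist (R : realType) (G : groupType) (S : {fset G})
    (h : G) (x y : G -> R) (l : R) : generates S -> path_length S x y l ->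
  y = vertex R h -> forall a b t, x = edge_pt a b t ->
  (1 - t) * (word_dist S a h)%:R + t * (word_dist S b h)%:R <= l.
Proof.
move=> gS; set f := fun k => (word_dist S k h)%:R : R.
have wdef a b t a' b' t' : edge_pt a b t = edge_pt a' b' t' ->
    (1 - t) * f a + t * f b = (1 - t') * f a' + t' * f b'.
  move=> E; pose r := undup [:: a; b; a'; b'].
  rewrite -!(@edge_pt_sum _ _ f r) ?undup_uniq ?mem_undup ?inE ?eqxx ?orbT //.
  by rewrite E.
elim=> [{}x yE a b t xE|g s t u {}y {}l sS t01 u01 _ IH yE a b v xE].
  have /wdef : edge_pt a b t = edge_pt h h 0 by rewrite -xE edge_pt0.
  rewrite -/(f a) -/(f b) => ->; rewrite subr0 mul0r addr0 mul1r.
  have /word_dist_le : word_val (nil : seq (letters S)) = (h^-1 * h)%g.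
    by rewrite /word_val big_nil mulVg.
  by rewrite leqn0 => /eqP fh; rewrite /f fh.
rewrite -/(f a) -/(f b) -(wdef _ _ _ _ _ _ xE).
have := IH yE _ _ _ erefl; rewrite -/(f g) -/(f (g * s)%g).
have le1 : f g <= f (g * s)%g + 1.
  by rewrite natr1 ler_nat; apply: word_dist_letter; rewrite // inE sS.
have le2 : f (g * s)%g <= f g + 1.
  rewrite natr1 ler_nat -{2}[g](mulgK s).
  apply: word_dist_letter; rewrite // inE; apply/orP; right.
  by apply/imfsetP; exists s.
move=> leu; have lef : `|f (g * s)%g - f g| <= 1 by rewrite ler_norml; lra.
have : (t - u) * (f (g * s)%g - f g) <= `|t - u|.
  rewrite (le_trans (ler_norm _))// normrM ler_piMr//.
lra.
Qed.

Definition cayley_vertex (R : realType) (G : groupType) (S : {fset G}) (g : G) :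
    cayley_graph R S :=
  exist _ (vertex R g) (or_introl (ex_intro _ g erefl)).

(** The word metric is the restriction of the path metric to the vertices. *)
Lemma cayley_dist_vertex (R : realType) (G : groupType) (S : {fset G})
    (g h : G) : generates S ->
  cayley_dist (cayley_vertex R S g) (cayley_vertex R S h)
    = (word_dist S g h)%:R.
Proof.
move=> gS; have [w wn wE] := word_dist_ex g h gS.
have P : path_length S (vertex R g) (vertex R h) (word_dist S g h)%:R.
  have := path_length_word R g w.
  by rewrite wE mulgA mulgV mul1g wn.
have L : lbound [set l | path_length S (vertex R g) (vertex R h) l]
                (word_dist S g h)%:R.
  move=> l /(path_length_word_dist gS)/(_ erefl g g 0).
  by rewrite edge_pt0 subr0 mul1r mul0r addr0; apply.
apply/eqP; rewrite eq_le /cayley_dist /=; apply/andP; split.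
  by apply: ge_inf => //; exists (word_dist S g h)%:R.
by apply: lb_le_inf => //; exists (word_dist S g h)%:R.
Qed.

(* Main.v *)
Require Import Defs.
From mathcomp Require Import all_boot all_order all_algebra finmap.
From mathcomp Require Import all_classical all_reals.
From mathcomp Require Import zify lra.

(** The contrapositive is proved: if the language [L] of the
    [(lambda, 0)]-quasigeodesic words is regular for some [lambda > 3], then
    geodesic triangles are thin.

    Regularity gives a local-to-global principle ([regular_extend]).  A prefix
    of a word of [L] matters only through the state it leads to, so it can be
    replaced by one of bounded length [N].  If a word ends with a long
    [(3, 0)]-quasigeodesic piece [x], the letters in front of [x] therefore
    behave like a bounded prefix, and a bounded prefix cannot use up the margin
    between [3] and [lambda] that [x] has accumulated.  So for some [M], a word
    of [L] whose last [M] letters are continued in a [(3, 0)]-quasigeodesic way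
    stays in [L].  In particular no closed loop can be a polygon with geodesic
    sides of length at least [M] in which each corner is a
    [(3, 0)]-quasigeodesic ([no_polygon]), since [L] contains no nonempty word
    that represents [1].

    Such corners are easy to find ([corner_left], [corner_right]): a geodesic
    followed by a shortest path from it to some point, or preceded by a shortest
    path from some point to it, is a [(3, 0)]-quasigeodesic.  Now take a
    geodesic triangle with a point [p] of one side far from the two others.
    Walking from [p] in both directions until the other sides are at distance
    [M], and joining the points reached to the other sides by shortest paths of
    length [M], one obtains a forbidden quadrilateral ([bigon]) or, with a third
    bridge between the two other sides, a forbidden hexagon ([thin]).
    Hence triangles of the word metric are [7 M]-thin.

    Finally this passes to the geometric realization.  A point on a geodesic of
    the realization is close to a vertex that almost realizes the distance
    between vertices near the ends, and such vertices are close to every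
    discrete geodesic between these ends ([thin_stable]). *)

Set Implicit Arguments.
Unset Strict Implicit.
Unset Printing Implicit Defensive.

Import Order.TTheory GRing.Theory Num.Theory.

(** * Words and the word metric *)

Section WordMetric.
Variables (G : groupType) (S : {fset G}).
Hypothesis hS : generates S.
Implicit Types (g h k : G) (u v w : seq (letters S)).

Local Notation d := (word_dist S).

(** Rewriting with [mulgA] leaves products that are only convertible to those
    of the other statements; this form keeps equal distances syntactically
    equal, as [lia] needs. *)
Lemma mulgA_group g h k : (g * (h * k))%g = (g * h * k)%g.
Proof. exact: mulgA. Qed.

Lemma word_val_nil : word_val ([::] : seq (letters S)) = 1%g.
Proof. exact: big_nil. Qed.

Lemma word_val_cat u v : word_val (u ++ v) = (word_val u * word_val v)%g.
Proof. exact: big_cat. Qed.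

Lemma word_distM k g h : d (k * g)%g (k * h)%g = d g h.
Proof. by rewrite /word_dist invgM -!mulgA mulKg. Qed.

Lemma word_dist_mulr g h : d g (g * h)%g = d 1%g h.
Proof. by rewrite -{1}[g]mulg1 word_distM. Qed.

Lemma word_dist_size g w : d g (g * word_val w)%g <= size w.
Proof. by apply: word_dist_le; rewrite mulKg. Qed.

Lemma word_distxx g : d g g = 0.
Proof.
by apply/eqP; rewrite -leqn0 -[X in d _ X]mulg1 -word_val_nil word_dist_size.
Qed.

Lemma word_dist_triangle h g k : d g k <= d g h + d h k.
Proof.
have [u <- uE] := word_dist_ex g h hS; have [v <- vE] := word_dist_ex h k hS.
rewrite -size_cat; apply: word_dist_le.
by rewrite word_val_cat uE vE mulgA mulgK.
Qed.

Lemma letters_inv g : g \in letters S -> (g^-1)%g \in letters S.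
Proof.
rewrite !inE => /orP[gS|/imfsetP[/= s sS ->]]; last by rewrite invgK sS.
by apply/orP; right; apply/imfsetP; exists g.
Qed.

Lemma word_dist_sym g h : d g h = d h g.
Proof.
suff le g' h' : d g' h' <= d h' g' by apply/eqP; rewrite eqn_leq !le.
have [w <- wE] := word_dist_ex h' g' hS.
have -> : h' = (g' * (word_val w)^-1)%g by rewrite wE invgM invgK mulVKg.
elim: w g' {wE} => [|a w IH] g'.
  by rewrite word_val_nil invg1 mulg1 word_distxx.
rewrite word_val_cons invgM mulgA /=.
apply: leq_trans (word_dist_triangle (g' * (word_val w)^-1)%g _ _) _.
rewrite -addn1 leq_add //.
have -> : (val a)^-1%g = word_val [:: [` letters_inv (valP a)]%fset].
  by rewrite word_val_cons word_val_nil mulg1.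
exact: word_dist_size.
Qed.

(** The [(3, 0)]-quasigeodesic words, with the inequality kept in [nat]. *)
Definition quasigeodesic3 w :=
  forall s u t, w = s ++ u ++ t -> size u <= 3 * d 1%g (word_val u).

Definition geodesic_from g h w := (g * word_val w)%g = h /\ size w = d g h.

Lemma geodesic_from_ex g h : exists w, geodesic_from g h w.
Proof.
have [w sw wE] := word_dist_ex g h hS.
by exists w; split; rewrite // wE mulVKg.
Qed.

Lemma geodesic_from_infix g h w s u t :
  geodesic_from g h w -> w = s ++ u ++ t -> size u = d 1%g (word_val u).
Proof.
move=> [<- sw] wE; apply/eqP; rewrite eqn_leq.
rewrite -[word_val u]mul1g word_dist_size mul1g andbT.
move: sw; rewrite wE !word_val_cat !size_cat !mulgA_group.
set x := (g * word_val s)%g.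
have := word_dist_size g s; rewrite -/x.
have := word_dist_size (x * word_val u)%g t.
have := word_dist_triangle x g (x * word_val u * word_val t)%g.
have := word_dist_triangle (x * word_val u)%g x (x * word_val u * word_val t)%g.
by rewrite word_dist_mulr; lia.
Qed.

Lemma quasigeodesic3_geodesic g h w : geodesic_from g h w -> quasigeodesic3 w.
Proof.
by move=> gw s u t /(geodesic_from_infix gw)->; rewrite leq_pmull.
Qed.

Lemma cat_eq_catl (T : Type) (s t u v : seq T) :
  s ++ t = u ++ v -> size s <= size u -> exists2 x, u = s ++ x & t = x ++ v.
Proof.
elim: s u => [|a s IH] [|b u] //=; try by move=> E _; exists (b :: u).
  by exists [::].
by rewrite ltnS => -[-> E] /(IH _ E)[x -> ->]; exists x.
Qed.

Lemma cat_infix_cases (T : Type) (s t u v w : seq T) : v ++ w = s ++ u ++ t ->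
  [\/ exists x, v = s ++ u ++ x, exists x, w = x ++ u ++ t |
    exists x y, [/\ v = s ++ x, w = y ++ t & u = x ++ y]].
Proof.
move=> E; have [vs|/ltnW sv] := leqP (size v) (size s).
  by have [x _ ->] := cat_eq_catl E vs; constructor 2; exists x.
have [v' -> {}E] := cat_eq_catl (esym E) sv.
have [uv|/ltnW vu] := leqP (size u) (size v').
  by have [x -> _] := cat_eq_catl E uv; constructor 1; exists x.
have [x -> ->] := cat_eq_catl (esym E) vu.
by constructor 3; exists v', x.
Qed.

(** Two geodesics that meet at [b] form a [(3, 0)]-quasigeodesic as soon as [b]
    is, among the points of the first one, a point nearest to the end [h] of the
    second.  Take a piece [s2] of the first side and a piece [t1] of the second,
    both ending at the corner, and let [D] be the distance between their far
    ends.  Moving along the second side from the end of [t1] to [h] costs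
    [size w2 - size t1], so nearness gives [size t1 <= D]; then
    [size s2 <= D + size t1 <= 2 D], and the two pieces have total length at
    most [3 D]. *)
Lemma corner_left a b h w1 w2 :
  geodesic_from a b w1 -> geodesic_from b h w2 ->
  (forall s t, w1 = s ++ t -> size w2 <= d (a * word_val s)%g h) ->
  quasigeodesic3 (w1 ++ w2).
Proof.
move=> g1 g2 far s1 u t2 /cat_infix_cases[[x E]|[x E]|[s2 [t1 [e1 e2 ->]]]].
- exact: (quasigeodesic3_geodesic g1 E).
- exact: (quasigeodesic3_geodesic g2 E).
have {far} := far _ _ e1.
have := geodesic_from_infix g1 (s := s1) (u := s2) (t := [::]).
rewrite cats0 => /(_ e1); have := geodesic_from_infix g2 (s := [::]) e2.
case: g1 g2 => [bE _] [hE _]; rewrite -{}hE -{}bE e1 e2.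
rewrite !word_val_cat !mulgA_group.
set x := (a * word_val s1)%g.
have := word_dist_size (x * word_val s2 * word_val t1)%g t2.
have := word_dist_triangle (x * word_val s2 * word_val t1)%g x
          (x * word_val s2 * word_val t1 * word_val t2)%g.
have := word_dist_triangle (word_val s2 * word_val t1)%g 1%g (word_val s2)%g.
rewrite (word_dist_sym (_ * _)%g (word_val s2)).
rewrite word_dist_mulr -(mulgA_group x) word_dist_mulr mulgA_group.
by rewrite !size_cat; lia.
Qed.

(** The mirror image: [b] is nearest to the start [a] of the first side among
    the points of the second side. *)
Lemma corner_right a b h w1 w2 :
  geodesic_from a b w1 -> geodesic_from b h w2 ->
  (forall s t, w2 = s ++ t -> size w1 <= d a (b * word_val s)%g) ->
  quasigeodesic3 (w1 ++ w2).
Proof.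
move=> g1 g2 far s1 u t2 /cat_infix_cases[[x E]|[x E]|[s2 [t1 [e1 e2 ->]]]].
- exact: (quasigeodesic3_geodesic g1 E).
- exact: (quasigeodesic3_geodesic g2 E).
have {far} := far _ _ e2.
have := geodesic_from_infix g1 (s := s1) (u := s2) (t := [::]).
rewrite cats0 => /(_ e1); have := geodesic_from_infix g2 (s := [::]) e2.
case: g1 => [bE _]; rewrite -{}bE e1 !word_val_cat !mulgA_group.
set x := (a * word_val s1)%g.
have := word_dist_size a s1; rewrite -/x.
have := word_dist_triangle x a (x * word_val s2 * word_val t1)%g.
rewrite -(mulgA_group x) word_dist_mulr mulgA_group.
have := word_dist_triangle 1%g (word_val s2) (word_val s2 * word_val t1)%g.
rewrite (word_dist_sym _ 1%g) word_dist_mulr.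
by rewrite !size_cat; lia.
Qed.
End WordMetric.

(** * Broken geodesics and thin triangles *)

Section Paths.
Variables (G : groupType) (S : {fset G}).
Hypothesis hS : generates S.
Implicit Types (g : G) (T : G -> Prop) (f e : nat -> G).

Local Notation d := (word_dist S).

Definition geodesic_path n f :=
  forall i j, i <= j -> j <= n -> d (f i) (f j) = j - i.

Definition on_path n f g := exists2 i, i <= n & f i = g.

Definition close_to T r g := exists2 t, T t & d g t <= r.

Lemma walk_word n f : (forall i, i < n -> d (f i) (f i.+1) = 1) ->
  exists2 w : seq (letters S), size w = n &
    forall i, i <= n -> (f 0 * word_val (take i w))%g = f i.
Proof.
elim: n => [|n IH] step.
  exists [::] => // i; rewrite leqn0 => /eqP ->.
  by rewrite take0 word_val_nil mulg1.
have [i lin|w sw wE] := IH; first by apply: step; rewrite ltnW.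
have [[|a [|//]]] := word_dist_ex (f n) (f n.+1) hS; rewrite step //= => _ aE.
exists (rcons w a); first by rewrite size_rcons sw.
move=> i; rewrite leq_eqVlt => /orP[/eqP->|lin].
  rewrite take_oversize ?size_rcons ?sw // -cats1 word_val_cat aE.
  by rewrite mulgA_group -[X in word_val X](take_size w) sw wE // mulVKg.
by rewrite -cats1 takel_cat ?sw // wE.
Qed.

(** The indices [i] and [j] come in either order: the loops below run along the
    sides of a triangle in both directions. *)
Lemma geodesic_subpath n f i j : geodesic_path n f -> i <= n -> j <= n ->
  exists2 w : seq (letters S), geodesic_from (f i) (f j) w &
    forall s t, w = s ++ t ->
      exists2 k, minn i j <= k <= maxn i j & (f i * word_val s)%g = f k.
Proof.
move=> gf lin ljn.
pose h l := if i <= j then f (i + l) else f (i - l).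
pose m := maxn i j - minn i j.
have [l lm|w sw wE] := @walk_word m h.
  rewrite /h; case: ifP => lij; first by rewrite gf; rewrite /m in lm *; lia.
  by rewrite (word_dist_sym hS) gf; rewrite /m in lm *; lia.
have h0 : h 0 = f i by rewrite /h addn0 subn0; case: ifP.
exists w.
  split.
    rewrite -[w]take_size sw -h0 wE // /h /m; case: ifP => lij; congr f; lia.
  case: (leqP i j) => [lij|/ltnW lji]; first by rewrite gf //; lia.
  by rewrite (word_dist_sym hS) gf; lia.
move=> s t E; have ls : size s <= m by rewrite -sw E size_cat leq_addr.
exists (if i <= j then i + size s else i - size s).
  by rewrite /m in ls; case: ifP; lia.
rewrite -h0 -(take_size_cat (s1 := s) t erefl) -E wE // /h.
by rewrite E take_size_cat //; case: ifP.
Qed.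

(** Since the distance to [T] changes by at most [1] at each step, the first
    point at distance at most [r] from [T] is at distance exactly [r]. *)
Lemma gate T f n r : (forall k, k < n -> d (f k) (f k.+1) <= 1) ->
  ~ close_to T r (f 0) -> close_to T r (f n) ->
  exists k t, [/\ k <= n, T t, d (f k) t = r &
    forall k' t', k' <= k -> T t' -> r <= d (f k') t'].
Proof.
move=> step far0 nearn.
have ex : exists k, (fun k => `[< close_to T r (f k) >]) k.
  by exists n; apply/asboolP.
case: (ex_minnP ex) => k /asboolP[t Tt le] kmin.
have kn : k <= n by apply: kmin; apply/asboolP.
have far k' t' : k' < k -> T t' -> r < d (f k') t'.
  move=> lt Tt'; rewrite ltnNge; apply/negP => le'.
  have /kmin : `[< close_to T r (f k') >] by apply/asboolP; exists t'.
  by rewrite leqNgt lt.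
case: k t Tt le kn far {kmin} => [|k] t Tt le kn far.
  by case: far0; exists t.
have farS t' : T t' -> r <= d (f k.+1) t'.
  move=> Tt'; have := far k t' (ltnSn k) Tt'.
  by have := word_dist_triangle hS (f k.+1) (f k) t'; have := step k kn; lia.
exists k.+1, t; split=> // [|k' t'].
  by apply/eqP; rewrite eqn_leq le farS.
by rewrite leq_eqVlt => /orP[/eqP-> /farS //|/far lt /lt /ltnW].
Qed.

(** Walk from [f i] in both directions until the distance to [T] drops to [r].
    The bridges from [f a1] to [ta] and from [f b1] to [tb] have length exactly
    [r], and every bridge realizes the distance between [T] and the whole of
    [f] from [a1] to [b1]: both of its ends are corners to which [corner_left]
    and [corner_right] apply. *)
Lemma gates n f i a b T r : geodesic_path n f -> a <= i -> i <= b -> b <= n ->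
  close_to T r (f a) -> close_to T r (f b) -> ~ close_to T r (f i) ->
  exists a1 b1 ta tb, [/\ [/\ a1 <= i, i <= b1 & b1 <= n], T ta, T tb &
    [/\ d (f a1) ta = r, d (f b1) tb = r &
      forall k t, a1 <= k -> k <= b1 -> T t -> r <= d (f k) t]].
Proof.
move=> gf lai lib lbn nra nrb nri.
have [|||ka [ta [lka Tta da fara]]] := @gate T (fun k => f (i - k)) (i - a) r.
- by move=> k lk; rewrite (word_dist_sym hS) gf; lia.
- by rewrite subn0.
- by rewrite subKn.
have [|||kb [tb [lkb Ttb db farb]]] := @gate T (fun k => f (i + k)) (b - i) r.
- by move=> k lk; rewrite gf; lia.
- by rewrite addn0.
- by rewrite subnKC.
exists (i - ka), (i + kb), ta, tb; split=> //; split=> //; try lia.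
move=> k t lak lkb' Tt; case: (leqP i k) => lik.
  by have := farb (k - i) t; rewrite /= subnKC // => -> //; lia.
by have := fara (i - k) t; rewrite /= (subKn (ltnW lik)) => -> //; lia.
Qed.

(** In this section [L] stands for the language of the
    [(lambda, 0)]-quasigeodesic words; [L_extend] is the local-to-global
    property that regularity will give. *)
Section LocalToGlobal.
Variables (L : seq (letters S) -> Prop) (M : nat).
Hypothesis M_gt0 : 0 < M.
Hypothesis L_quasigeodesic3 : forall w, quasigeodesic3 w -> L w.
Hypothesis L_extend : forall t w z,
  M <= size w -> L (t ++ w) -> quasigeodesic3 (w ++ z) -> L (t ++ w ++ z).
Hypothesis L_loop : forall w, L w -> word_val w = 1%g -> w = [::].

(** A broken line with long sides, all of whose corners are
    [(3, 0)]-quasigeodesic; the last side may have any length. *)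
Fixpoint chain w (ws : seq (seq (letters S))) :=
  if ws is v :: ws' then
    [/\ M <= size w, quasigeodesic3 (w ++ v) & chain v ws']
  else True.

Lemma chain_extend t w ws :
  L (t ++ w) -> chain w ws -> L (t ++ w ++ flatten ws).
Proof.
elim: ws t w => [|v ws IH] t w Ltw /=; first by rewrite cats0.
by move=> [Mw q /(IH (t ++ w))]; rewrite -!catA; apply; exact: L_extend.
Qed.

(** Along a chain, [L_extend] only ever looks at two consecutive sides, so the
    whole chain lies in [L], and words of [L] do not close up. *)
Lemma no_polygon g h w ws : geodesic_from g h w -> M <= size w ->
  chain w ws -> word_val (w ++ flatten ws) <> 1%g.
Proof.
move=> gw Mw /(@chain_extend [::]) ch.
have /ch/L_loop loop : L ([::] ++ w).
  by apply: L_quasigeodesic3; exact: quasigeodesic3_geodesic gw.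
by move=> /loop/(congr1 size); rewrite /= size_cat; lia.
Qed.

(** Otherwise gates at distance [r] on the two sides of [f i], the two bridges
    from them to [e], and the parts of [f] and [e] between the ends of the bridges
    would form a forbidden quadrilateral. *)
Lemma bigon n m f e i a b r : geodesic_path n f -> geodesic_path m e ->
  M <= r -> a <= i -> i <= b -> b <= n ->
  close_to (on_path m e) r (f a) -> close_to (on_path m e) r (f b) ->
  close_to (on_path m e) (2 * r + M) (f i).
Proof.
move=> gf ge Mr lai lib lbn na nb; apply: contrapT => ni.
have ni' : ~ close_to (on_path m e) r (f i).
  by move=> [t et le]; apply: ni; exists t => //; lia.
have [a1 [b1 [ta [tb [[la1 lb1 lb1n] eta etb [da db far]]]]]] :=
  gates gf lai lib lbn na nb ni'.
have fari t : on_path m e t -> 2 * r + M < d (f i) t.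
  by move=> et; rewrite ltnNge; apply/negP => le; apply: ni; exists t.
have la : r + M < i - a1.
  have := fari _ eta; have := word_dist_triangle hS (f a1) (f i) ta.
  by rewrite (word_dist_sym hS (f i) (f a1)) (gf a1 i); lia.
have lb : r + M < b1 - i.
  have := fari _ etb; have := word_dist_triangle hS (f b1) (f i) tb.
  by rewrite (gf i b1); lia.
have dab : d (f a1) (f b1) = b1 - a1 by apply: gf; lia.
case: (etb) (eta) => [jb ljb jbE] [ja lja jaE].
have la1n : a1 <= n by lia.
have [w1 g1 on1] := geodesic_subpath gf la1n lb1n.
have [w2 g2] := geodesic_from_ex hS (f b1) tb.
have [w3 g3 on3] := geodesic_subpath ge ljb lja.
have [w4 g4] := geodesic_from_ex hS ta (f a1).
rewrite jbE jaE in g3.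
have [[[[v1 s1] [v2 s2]] [v3 s3]] [v4 s4]] := (g1, g2, g3, g4).
have d3 : M <= size w3.
  rewrite s3; have := word_dist_triangle hS ta (f a1) (f b1).
  have := word_dist_triangle hS tb ta (f b1).
  by rewrite (word_dist_sym hS ta tb) (word_dist_sym hS tb (f b1)); lia.
have away k t :
    minn a1 b1 <= k <= maxn a1 b1 -> on_path m e t -> r <= d (f k) t.
  by move=> lk et; apply: far => //; lia.
have L1 : M <= size w1 by lia.
have /= loop := @no_polygon _ _ w1 [:: w2; w3; w4] g1 L1; apply: loop.
  split=> //; [|split=> //; [lia| |split=> //]].
  - apply: (corner_left hS g1 g2) => s t /on1[k lk ->].
    by rewrite s2 db away.
  - apply: (corner_right hS g2 g3) => s t /on3[k lk].
    rewrite -jbE => ->; rewrite s2 db away //; first by lia.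
    by exists k => //; lia.
  - apply: (corner_left hS g3 g4) => s t /on3[k lk].
    rewrite -jbE => ->; rewrite s4 (word_dist_sym hS) da.
    rewrite (word_dist_sym hS) away //.
      by lia.
    by exists k => //; lia.
apply: (mulgI (f a1)); rewrite mulg1 !word_val_cat word_val_nil mulg1.
by rewrite !mulgA_group v1 v2 v3 v4.
Qed.

(** The sides are [f] from [x] to [y], [e] between [x] and [z], and [c] from
    [y] to [z].  If [f i] were far from the other two sides, one would find
    gates [a] and [b] around it at distance [M] from these sides.  When the feet
    of the two bridges do not lie on [e] for [a] and on [c] for [b], one side
    stays near [f] on both sides of [i], against [bigon].  In the main case, a
    third bridge of length [M] joins [c] to [e], at the first point of [c]
    after [tb] that comes so close to [e].  The three bridges and the three
    pieces of sides between them form a forbidden hexagon. *)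
Lemma thin n m p f e c i : geodesic_path n f -> geodesic_path m e ->
  geodesic_path p c -> on_path m e (f 0) -> on_path p c (f n) ->
  on_path m e (c p) -> i <= n ->
  close_to (fun g => on_path m e g \/ on_path p c g) (7 * M) (f i).
Proof.
move=> gf ge gc e0 cn ep lin; apply: contrapT => far7.
set T := fun g => _ in far7.
have self U r g : U g -> close_to U r g by exists g; rewrite ?word_distxx.
have nearT U r : (forall h, U h -> T h) -> r <= 7 * M -> close_to U r (f i) ->
  False.
  by move=> UT le [t Ut lt]; apply: far7; exists t; [exact: UT | lia].
have eT h : on_path m e h -> T h by left.
have cT h : on_path p c h -> T h by right.
have [||||||a [b [ta [tb [[la lb lbn] Tta Ttb [da db far]]]]]] :=
  @gates n f i 0 n T M gf => //.
- by apply: self; left.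
- by apply: self; right.
- by apply: (nearT T) => //; lia.
have na U : U ta -> close_to U M (f a) by exists ta; rewrite ?da.
have nb U : U tb -> close_to U M (f b) by exists tb; rewrite ?db.
have le73 : 2 * M + M <= 7 * M by lia.
case: (Tta) (Ttb) => [eta|cta] [etb|ctb].
- apply: (nearT _ _ eT le73).
  by apply: (bigon gf ge _ la lb lbn); [|exact: na|exact: nb].
(* Here [b] is far from [e] and [a] is far from [c], again by [bigon]; this is
   what makes the pieces of [c] and of [e] in the hexagon long. *)
- have le77 : 2 * (3 * M) + M <= 7 * M by lia.
  have farb t : on_path m e t -> 3 * M < d (f b) t.
    move=> et; rewrite ltnNge; apply/negP => le; apply: (nearT _ _ eT le77).
    apply: (bigon gf ge _ (leq0n i) lb lbn); first by lia.
      exact: self.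
    by exists t.
  have fara t : on_path p c t -> 3 * M < d (f a) t.
    move=> ct; rewrite ltnNge; apply/negP => le; apply: (nearT _ _ cT le77).
    apply: (bigon gf gc _ la lin (leqnn n)); first by lia.
      by exists t.
    exact: self.
  case: (ctb) (eta) => [jb ljb jbE] [ja lja jaE].
  have [|||q [tc [lq etc dc farc]]] :=
      @gate (on_path m e) (fun k => c (jb + k)) (p - jb) M.
  + by move=> k lk; rewrite gc; lia.
  + rewrite addn0 jbE => -[t et le].
    by have := farb t et; have := word_dist_triangle hS tb (f b) t; lia.
  + by rewrite subnKC //; apply: self.
  case: (etc) => [jc ljc jcE].
  have lqp : jb + q <= p by lia.
  have lan : a <= n by lia.
  have [w1 g1 on1] := geodesic_subpath gf lan lbn.
  have [w2 g2] := geodesic_from_ex hS (f b) tb.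
  have [w3 g3 on3] := geodesic_subpath gc ljb lqp.
  have [w4 g4] := geodesic_from_ex hS (c (jb + q)) tc.
  have [w5 g5 on5] := geodesic_subpath ge ljc lja.
  have [w6 g6] := geodesic_from_ex hS ta (f a).
  rewrite jbE in g3; rewrite jaE jcE in g5.
  have [[[v1 s1] [v2 s2]] [v3 s3]] := (g1, g2, g3).
  have [[[v4 s4] [v5 s5]] [v6 s6]] := (g4, g5, g6).
  have L1 : M <= size w1.
    have /negP : ~ d (f i) ta <= 7 * M by move=> le; apply: far7; exists ta.
    rewrite -ltnNge s1 gf //; last by lia.
    have := word_dist_triangle hS (f a) (f i) ta.
    by rewrite (word_dist_sym hS (f i) (f a)) gf //; lia.
  have L3 : M <= size w3.
    have := farb _ etc; have := word_dist_triangle hS tb (f b) tc.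
    by have := word_dist_triangle hS (c (jb + q)) tb tc; lia.
  have L5 : M <= size w5.
    have : on_path p c (c (jb + q)) by exists (jb + q).
    move=> /fara; have := word_dist_triangle hS ta (f a) (c (jb + q)).
    have := word_dist_triangle hS tc ta (c (jb + q)).
    by rewrite (word_dist_sym hS tc (c _)) (word_dist_sym hS ta tc); lia.
  have /= loop := @no_polygon _ _ w1 [:: w2; w3; w4; w5; w6] g1 L1; apply: loop.
    split=> //; [|split; [lia| |split=> //; [|split; [lia| |split=> //]]]].
    + apply: (corner_left hS g1 g2) => s t /on1[k lk ->].
      by rewrite s2 db far //; lia.
    + apply: (corner_right hS g2 g3) => s t /on3[k lk].
      rewrite -jbE => ->; rewrite s2 db far //; first by lia.
      by apply: cT; exists k => //; lia.
    + apply: (corner_left hS g3 g4) => s t /on3[k lk].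
      rewrite -jbE => ->; rewrite s4 dc.
      have := farc (k - jb) tc; rewrite /= subnKC; last by lia.
      by move=> -> //; lia.
    + apply: (corner_right hS g4 g5) => s t /on5[k lk].
      rewrite -jcE => ->; rewrite s4 dc.
      by apply: farc => //; exists k => //; lia.
    + apply: (corner_left hS g5 g6) => s t /on5[k lk].
      rewrite -jcE => ->; rewrite s6 (word_dist_sym hS) da.
      rewrite (word_dist_sym hS) far //.
        by lia.
      by apply: eT; exists k => //; lia.
  apply: (mulgI (f a)); rewrite mulg1 !word_val_cat word_val_nil mulg1.
  by rewrite !mulgA_group v1 v2 v3 v4 v5 v6.
- apply: (nearT _ _ eT le73).
  by apply: (bigon gf ge _ (leq0n i) lb lbn); [|exact: self|exact: nb].
- apply: (nearT _ _ cT le73).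
  by apply: (bigon gf gc _ la lb lbn); [|exact: na|exact: nb].
Qed.

End LocalToGlobal.

End Paths.

(** * Regular languages of quasigeodesics *)

(** There are finitely many sets of states that a prefix can lead to, and this
    set determines which continuations are accepted. *)
Lemma regular_short_prefix (A : finType) (L : set (seq A)) : regular L ->
  exists N, forall t,
    exists2 t', size t' <= N & forall z, L (t ++ z) <-> L (t' ++ z).
Proof.
move=> [M ->].
pose step (Q : {set state M}) a : {set state M} :=
  [set q' | [exists q in Q, edge q a q']].
pose run := foldl step.
have acceptsE (w : seq A) (Q : {set state M}) :
    (exists2 q : state M, q \in Q & accepts_from q w) <->
    (exists2 q : state M, q \in run Q w & q \in final M).
  elim: w Q => [|a w IH] Q //=; rewrite -IH; split.
    move=> [q qQ [q' qq' acc]]; exists q' => //.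
    by rewrite inE; apply/existsP; exists q; rewrite qQ.
  move=> [q']; rewrite inE => /existsP[q /andP[qQ qq']] acc.
  by exists q => //; exists q'.
pose Q0 : {set state M} := [set initial M].
have accE (w : seq A) :
    accepts M w <-> exists2 q : state M, q \in run Q0 w & q \in final M.
  rewrite -acceptsE; split=> [acc|[q]].
    by exists (initial M); rewrite ?inE.
  by rewrite inE => /eqP->.
pose rep Q := xget [::] [set t | run Q0 t = Q]%classic.
exists (\max_Q size (rep Q)) => t.
exists (rep (run Q0 t)); first exact: leq_bigmax.
have repE : run Q0 (rep (run Q0 t)) = run Q0 t.
  by apply: (@xgetPex _ [::] [set t' | run Q0 t' = run Q0 t]%classic); exists t.
by move=> z; rewrite /= !accE /run !foldl_cat -/run repE.
Qed.

Local Open Scope ring_scope.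

(** The key use of regularity.  Add the letters of [z] one by one, and suppose
    that the word first leaves the language at [t ++ x], where [x] starts with
    [w].  Replace [t] by a prefix [t'] of length at most [N] with the same
    continuations.  Then [t' ++ x] is not in the language either, and all its
    proper prefixes are, so that it has a bad suffix; as [x] itself is
    [(3, 0)]-quasigeodesic, this suffix is [y ++ x] with [size y <= N].  But a
    prefix of bounded length cannot spoil [x]: since [3 < lambda], the quantity
    [lambda * d(1, x) - size x] is at least [(lambda / 3 - 1) * size x], which
    exceeds [(1 + lambda) * N] once [x] is long. *)
Lemma regular_extend (R : realType) (G : groupType) (S : {fset G})
    (hS : generates S) (lambda : R) : 3 < lambda ->
  regular [set w : seq (letters S) | quasigeodesic_word lambda 0 w]%classic ->
  exists2 M, (0 < M)%N & forall t w z : seq (letters S), (M <= size w)%N ->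
    quasigeodesic_word lambda 0 (t ++ w) -> quasigeodesic3 (w ++ z) ->
    quasigeodesic_word lambda 0 (t ++ w ++ z).
Proof.
move=> l3 /regular_short_prefix[N short0].
have {short0} short (t : seq (letters S)) : exists2 t' : seq (letters S),
    (size t' <= N)%N & forall z, quasigeodesic_word lambda 0 (t ++ z) <->
      quasigeodesic_word lambda 0 (t' ++ z).
  by have [t' t'N t'E] := short0 t; exists t'.
(* [K] is the length beyond which [y] cannot spoil [x]. *)
pose K := (1 + lambda) * N%:R / (lambda / 3 - 1).
have K0 : 0 <= K by rewrite /K divr_ge0 ?mulr_ge0 ?ler0n //; lra.
exists (Num.bound K).+1 => // t w z Mw qtw.
have KM : K < (size w)%:R.
  by apply: lt_le_trans (archi_boundP K0) _; rewrite ler_nat ltnW.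
elim/last_ind: z => [|z a IH] q3; first by rewrite cats0.
have {}IH : quasigeodesic_word lambda 0 (t ++ w ++ z).
  apply: IH => s u v E; apply: (q3 s u (rcons v a)).
  by rewrite -rcons_cat E -!rcons_cat.
have [t' t'N t'E] := short t.
apply/t'E => v; rewrite -rcons_cat -rcons_cat infix_rconsl.
move=> /orP[|]; last first.
  by move: v; apply/t'E.
rewrite rcons_cat [rcons (w ++ z) a]rcons_cat.
move: q3; set x := w ++ rcons z a => q3 suf.
have {suf} [s E] : exists s : seq (letters S), s ++ v = t' ++ x.
  by have /suffixP[s ->] := suf; exists s.
have [lsu|lsu] := leqP (size t') (size s).
  have [y _ xE] := cat_eq_catl (esym E) lsu.
  have := q3 y v [::]; rewrite cats0 addr0 => /(_ xE).
  rewrite -(ler_nat R) natrM => /le_trans; apply.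
  by rewrite ler_wpM2r ?ler0n //; lra.
have [y t'yE vE] := cat_eq_catl E (ltnW lsu).
have xw : (size w <= size x)%N by rewrite /x size_cat leq_addr.
have := q3 [::] x [::]; rewrite cats0 => /(_ erefl) x3.
have yN : (size y <= N)%N.
  by apply: leq_trans t'N; rewrite t'yE size_cat leq_addl.
have dx : (word_dist S 1%g (word_val x)
             <= size y + word_dist S 1%g (word_val v))%N.
  rewrite vE word_val_cat -(word_dist_mulr S (word_val y)).
  apply: leq_trans (word_dist_triangle hS 1%g _ _) _.
  rewrite leq_add2r word_dist_sym //.
  by have := word_dist_size 1%g y; rewrite mul1g.
rewrite addr0 leNgt; apply/negP; rewrite vE size_cat natrD -vE.
set D := (word_dist _ _ _)%:R => lt.
have : K * (lambda / 3 - 1) = (1 + lambda) * N%:R.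
  by rewrite /K divfK // gt_eqF //; lra.
move: KM xw x3 yN dx; rewrite -!(ler_nat R) natrM natrD -/D.
set X := (word_dist _ _ _)%:R; move: lt.
move: (size x)%:R (size y)%:R (size w)%:R N%:R => x' y' w' N' lt Kw wx xX yN XD.
have h1 : 0 <= lambda * (D + y' - x' / 3) by apply: mulr_ge0; lra.
have h2 : 0 <= (1 + lambda) * (N' - y') by apply: mulr_ge0; lra.
have h3 : 0 < (x' - K) * (lambda / 3 - 1) by apply: mulr_gt0; lra.
lra.
Qed.

(** * From the word metric to the Cayley graph *)

Section Stability.
Local Open Scope nat_scope.
Variables (G : groupType) (S : {fset G}).
Hypothesis hS : generates S.
Implicit Types (f e c : nat -> G).
Local Notation d := (word_dist S).

Lemma geodesic_path_ex (x y : G) :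
  exists n f, [/\ geodesic_path S n f, f 0 = x, f n = y & n = d x y].
Proof.
have [w gw] := geodesic_from_ex hS x y.
exists (size w), (fun i => x * word_val (take i w))%g; split; last by case: gw.
- move=> i j lij ljn.
  have jE : take j w = take i w ++ drop i (take j w).
    by rewrite -[LHS](cat_take_drop i) take_takel.
  have wE : w = take i w ++ drop i (take j w) ++ drop j w.
    by rewrite catA -jE cat_take_drop.
  rewrite jE word_val_cat mulgA_group word_dist_mulr.
  by rewrite -(geodesic_from_infix hS gw wE) size_drop size_takel.
- by rewrite take0 word_val_nil mulg1.
- by rewrite take_size; case: gw.
Qed.

(** The endpoint conditions say that the three sides meet pairwise.  Closeness
    is asserted for one side only, since the sides can be permuted. *)
Definition thin_triangles D :=
  forall n m p f e c i, geodesic_path S n f -> geodesic_path S m e ->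
  geodesic_path S p c -> on_path m e (f 0) -> on_path p c (f n) ->
  on_path m e (c p) -> i <= n ->
  close_to S (fun g => on_path m e g \/ on_path p c g) D (f i).

(** In the triangle with vertices [f 0], [g], [f n], a connectedness argument
    finds a point [f i] close to both sides through [g], at [e j] and at [c k].
    The detour through [g] between these two points is longer than a path
    through [f i] by at most the excess [C] and the thinness, which bounds the
    distance from [f i] to [g]. *)
Lemma thin_stable D n f g C : thin_triangles D -> geodesic_path S n f ->
  d (f 0) g + d g (f n) <= n + C ->
  close_to S (on_path n f) (3 * (D + 1) + C) g.
Proof.
move=> thinD gf le.
have [m [e [ge e0 em mE]]] := geodesic_path_ex (f 0) g.
have [p [c [gc c0 cp pE]]] := geodesic_path_ex (f n) g.
have close i : i <= n ->
    close_to S (on_path m e) D (f i) \/ close_to S (on_path p c) D (f i).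
  move=> lin; have [|||t [et|ct] lt] := thinD _ _ _ _ _ _ i gf ge gc _ _ _ lin.
  - by exists 0.
  - by exists 0.
  - by exists m => //; rewrite em cp.
  - by left; exists t.
  - by right; exists t.
have nc : close_to S (on_path p c) D (f n).
  by exists (f n); [exists 0 | rewrite word_distxx].
have ex : exists i, (fun i => `[< close_to S (on_path p c) D (f i) >]) i.
  by exists n; apply/asboolP.
case: (ex_minnP ex) => i /asboolP[t [k lkp <-] lt] imin {t}.
have lin : i <= n by apply: imin; apply/asboolP.
have [_ [j ljm <-] ls] : close_to S (on_path m e) (D + 1) (f i).
  case: i imin lin lt => [|i] imin lin lt.
    by exists (f 0); [exists 0 | rewrite word_distxx].
  case: (close i (ltnW lin)) => [[t et le']|/asboolP/imin]; last first.
    by rewrite ltnn.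
  exists t => //; have := word_dist_triangle hS (f i) (f i.+1) t.
  by rewrite (word_dist_sym hS (f i.+1) (f i)) gf //; lia.
exists (f i); first by exists i.
have fn : d (f 0) (f n) = n by rewrite gf //; lia.
have := word_dist_triangle hS (e j) (f 0) (f n).
have := word_dist_triangle hS (f i) (e j) (f n).
have := word_dist_triangle hS (c k) (f i) (f n).
have := word_dist_triangle hS (e j) g (f i).
have ej1 : d (f 0) (e j) = j by rewrite -e0 ge //; lia.
have ej2 : d g (e j) = m - j by rewrite (word_dist_sym hS) -em ge.
have ck : d (c k) (f n) = k by rewrite (word_dist_sym hS) -c0 gc //; lia.
rewrite (word_dist_sym hS (e j) (f i)) (word_dist_sym hS g (f n)) in le *.
lia.
Qed.

End Stability.

Section CayleyMetric.
Variables (R : realType) (G : groupType) (S : {fset G}).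
Hypothesis hS : generates S.

Local Notation X := (cayley_graph R S).
Local Notation dX := (@cayley_dist R G S).
Local Notation d := (word_dist S).
Local Notation vtx := (cayley_vertex R S).

Lemma path_length_ge0 (x y : G -> R) l : path_length S x y l -> 0 <= l.
Proof. by elim=> // *; rewrite addr_ge0. Qed.

Lemma path_length_cat (x y z : G -> R) l m :
  path_length S x y l -> path_length S y z m -> path_length S x z (l + m).
Proof.
elim=> [{}x yz|g s t u {}y {}l sS t01 u01 _ IH yz]; first by rewrite add0r.
by rewrite -addrA; apply: path_length_cons => //; apply: IH.
Qed.

Lemma path_length_edge g s (t u : R) : s \in S -> 0 <= t <= 1 -> 0 <= u <= 1 ->
  path_length S (edge_pt g (g * s)%g t) (edge_pt g (g * s)%g u) `|t - u|.
Proof.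
move=> sS t01 u01; rewrite -[X in path_length _ _ _ X]addr0.
by apply: path_length_cons => //; constructor.
Qed.

Lemma path_length_rev (x y : G -> R) l :
  path_length S x y l -> path_length S y x l.
Proof.
elim=> [{}x|g s t u {}y {}l sS t01 u01 _ IH]; first by constructor.
rewrite addrC distrC; apply: path_length_cat IH _; exact: path_length_edge.
Qed.

Lemma path_length_vertex (x : X) :
  exists g l, path_length S (sval x) (vertex R g) l /\ l <= 1.
Proof.
case: x => x /= [[g ->]|[g [s [t [sS t01 ->]]]]].
  by exists g, 0; split; [constructor|].
exists g, `|t - 0|; split; last by rewrite subr0 ger0_norm; lra.
by rewrite -(edge_pt0 R g (g * s)%g); apply: path_length_edge => //; lra.
Qed.

Lemma path_length_ex (x y : X) : exists l, path_length S (sval x) (sval y) l.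
Proof.
have [g [l [xg _]]] := path_length_vertex x.
have [h [m [yh _]]] := path_length_vertex y.
have [w wE] := hS (g^-1 * h)%g.
have gh := path_length_word R g w; rewrite wE mulVKg in gh.
exists (l + ((size w)%:R + m)); apply: path_length_cat xg _.
by apply: path_length_cat gh _; apply: path_length_rev.
Qed.

Lemma cayley_dist_le (x y : X) l :
  path_length S (sval x) (sval y) l -> dX x y <= l.
Proof.
move=> xy; apply: ge_inf => //; exists 0 => m; exact: path_length_ge0.
Qed.

Lemma cayley_dist_sym (x y : X) : dX x y = dX y x.
Proof.
by rewrite /cayley_dist; congr inf; apply/seteqP; split=> l;
  exact: path_length_rev.
Qed.

Lemma cayley_dist_ge0 (x y : X) : 0 <= dX x y.
Proof.
apply: lb_le_inf; first exact: path_length_ex.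
move=> l; exact: path_length_ge0.
Qed.

Lemma cayley_dist_triangle (y x z : X) : dX x z <= dX x y + dX y z.
Proof.
rewrite -lerBlDr; apply: lb_le_inf; first exact: path_length_ex.
move=> l xy; rewrite lerBlDr addrC -lerBlDr; apply: lb_le_inf.
  exact: path_length_ex.
move=> m yz; rewrite lerBlDr addrC; apply: cayley_dist_le.
exact: path_length_cat xy yz.
Qed.

Lemma cayley_dist_near_vertex (x : X) : exists g, dX x (vtx g) <= 1.
Proof.
have [g [l [xg l1]]] := path_length_vertex x; exists g.
by apply: le_trans l1; apply: cayley_dist_le.
Qed.

(** What is needed of a geodesic from [x] to [y], in a form that is symmetric
    in [x] and [y] and speaks of distances only. *)
Definition spans (x y : X) (A : set X) :=
  (forall p, A p -> dX x p + dX p y = dX x y) /\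
  (forall t, 0 <= t <= dX x y ->
     exists p, [/\ A p, dX x p = t & dX p y = dX x y - t]).

Lemma geodesic_spans x y A : geodesic dX x y A -> spans x y A.
Proof.
move=> [l [c [l0 <- <- iso ->]]].
have dE : dX (c 0) (c l) = l.
  by rewrite iso ?sub0r ?normrN ?ger0_norm // lexx ?l0.
have both t : 0 <= t <= l -> dX (c 0) (c t) = t /\ dX (c t) (c l) = l - t.
  move=> tl; rewrite !iso ?lexx ?l0 // sub0r normrN distrC !ger0_norm //; lra.
rewrite /spans dE; split=> [_ [t tl <-]|t tl].
  by have [-> ->] := both t tl; rewrite addrC subrK.
by have [e1 e2] := both t tl; exists (c t); split=> //; exists t.
Qed.

Lemma spans_sym x y A : spans x y A -> spans y x A.
Proof.
move=> [sum reach]; split=> [p /sum|t tl].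
  rewrite addrC (cayley_dist_sym y p) (cayley_dist_sym p x).
  by rewrite (cayley_dist_sym y x).
rewrite cayley_dist_sym in tl *.
have [|p [Ap e1 e2]] := reach (dX x y - t); first by lra.
exists p; rewrite (cayley_dist_sym y p) (cayley_dist_sym p x) e1 e2; split=> //.
lra.
Qed.

Lemma cayley_dist_vtx g h : dX (vtx g) (vtx h) = (d g h)%:R.
Proof. exact: cayley_dist_vertex. Qed.

Lemma word_dist_near (x y : X) g h : dX x (vtx g) <= 1 -> dX y (vtx h) <= 1 ->
  dX x y - 2 <= (d g h)%:R <= dX x y + 2.
Proof.
move=> xg yh; rewrite -cayley_dist_vtx.
have := cayley_dist_triangle x (vtx g) (vtx h).
have := cayley_dist_triangle y x (vtx h).
have := cayley_dist_triangle (vtx g) x y.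
have := cayley_dist_triangle (vtx h) (vtx g) y.
rewrite (cayley_dist_sym (vtx h) y) (cayley_dist_sym (vtx g) x); lra.
Qed.

(** The excess [6] comes from moving three points of the realization to vertices
    at distance at most [1]: the two ends, and a point between them. *)
Variables D E : nat.
Hypothesis thinD : thin_triangles S D.
Hypothesis stableE : forall n f g, geodesic_path S n f ->
  (d (f 0) g + d g (f n) <= n + 6)%N -> close_to S (on_path n f) E g.

Lemma between_close (x y p : X) x' y' p' n f :
  dX x p + dX p y = dX x y ->
  dX x (vtx x') <= 1 -> dX y (vtx y') <= 1 -> dX p (vtx p') <= 1 ->
  geodesic_path S n f -> f 0%N = x' -> f n = y' ->
  close_to S (on_path n f) E p'.
Proof.
move=> xpy xx' yy' pp' gf f0 fn; apply: stableE => //.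
have nE : n = d x' y' by rewrite -f0 -fn gf // subn0.
rewrite f0 fn [X in (_ <= X + _)%N]nE -(ler_nat R) !natrD.
have /andP[_ l1] := word_dist_near xx' pp'.
have /andP[_ l2] := word_dist_near pp' yy'.
have /andP[l3 _] := word_dist_near xx' yy'.
lra.
Qed.

(** Compare [e k] with the point of [B] at the same distance from [y], up to the
    errors at the ends. *)
Lemma spans_chase (y z : X) B y' z' m e k :
  spans y z B -> dX y (vtx y') <= 1 -> dX z (vtx z') <= 1 ->
  geodesic_path S m e -> e 0%N = y' -> e m = z' -> (k <= m)%N ->
  exists2 b, B b & dX (vtx (e k)) b <= (2 * E + 5)%:R.
Proof.
move=> [sum reach] yy' zz' ge e0 em lkm.
(* [e] may be longer than [B] by [2], hence the minimum. *)
pose t := Num.min k%:R (dX y z).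
have mE : m = d y' z' by rewrite -e0 -em ge // subn0.
have /andP[_ mle] := word_dist_near yy' zz'.
have kt : t <= k%:R <= t + 2.
  have : k%:R <= m%:R :> R by rewrite ler_nat.
  by rewrite mE /t; case: (lerP k%:R (dX y z)); lra.
have [|b [Bb yb bz]] := reach t.
  by rewrite /t le_min ge_min ler0n cayley_dist_ge0 lexx orbT.
have [b' bb'] := cayley_dist_near_vertex b.
exists b => //.
have [_ [k2 lk2 <-] le] :=
  between_close (sum b Bb) yy' zz' bb' ge e0 em.
have yk2 : d y' (e k2) = k2 by rewrite -e0 ge // subn0.
have /andP[t1 t2] := word_dist_near yy' bb'.
have := word_dist_triangle hS b' y' (e k2).
have := word_dist_triangle hS (e k2) y' b'.
rewrite (word_dist_sym hS (e k2) b') yk2 => u1 u2.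
have kk2 : (d (e k) (e k2) <= E + 4)%N.
  have a1 : (k <= d y' b' + 2 + 2)%N.
    by rewrite -(ler_nat R) !natrD; lra.
  have a2 : (d y' b' <= k + 2)%N by rewrite -(ler_nat R) !natrD; lra.
  have [l|/ltnW l] := leqP k k2; first by rewrite ge //; lia.
  by rewrite (word_dist_sym hS) ge //; lia.
apply: le_trans (cayley_dist_triangle (vtx b') _ _) _.
rewrite cayley_dist_vtx (cayley_dist_sym (vtx b')).
have : (d (e k) b' <= 2 * E + 4)%N.
  have := word_dist_triangle hS (e k2) (e k) b'.
  by rewrite (word_dist_sym hS (e k2) b'); lia.
rewrite -(ler_nat R) !natrD => v1; lra.
Qed.

(** A point of [A] is close to a discrete geodesic between vertices near [x]
    and [y], hence, by thinness, to one near another side, hence to that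
    side. *)
Lemma thin_side (x y z : X) A B C : spans x y A -> spans y z B -> spans x z C ->
  within_nbhd dX (3 * E + D + 6)%:R A (B `|` C)%classic.
Proof.
move=> [sum _] spB spC p Ap.
have [x' xx'] := cayley_dist_near_vertex x.
have [y' yy'] := cayley_dist_near_vertex y.
have [z' zz'] := cayley_dist_near_vertex z.
have [p' pp'] := cayley_dist_near_vertex p.
have [n [f [gf f0 fn _]]] := geodesic_path_ex hS x' y'.
have [m [e [ge e0 em _]]] := geodesic_path_ex hS x' z'.
have [l [c [gc c0 cl _]]] := geodesic_path_ex hS y' z'.
have [_ [i lin <-] pi] := between_close (sum p Ap) xx' yy' pp' gf f0 fn.
have e0f : on_path m e (f 0%N) by exists 0%N; rewrite ?e0 ?f0.
have c0f : on_path l c (f n) by exists 0%N; rewrite ?c0 ?fn.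
have emc : on_path m e (c l) by exists m; rewrite ?em ?cl.
have [t et it] := thinD gf ge gc e0f c0f emc lin.
have [b Bb tb] : exists2 b, (B `|` C)%classic b
    & dX (vtx t) b <= (2 * E + 5)%:R.
  case: et => -[k lk <-].
    by have [b] := spans_chase spC xx' zz' ge e0 em lk; exists b => //; right.
  by have [b] := spans_chase spB yy' zz' gc c0 cl lk; exists b => //; left.
exists b => //; apply: le_trans (cayley_dist_triangle (vtx p') _ _) _.
have := cayley_dist_triangle (vtx t) (vtx p') b; rewrite cayley_dist_vtx.
have : (d p' t <= E + D)%N.
  by have := word_dist_triangle hS (f i) p' t; lia.
rewrite -(ler_nat R) => a1 a2.
move: tb a1; rewrite !(natrM, natrD); lra.
Qed.

Lemma thin_triangles_hyperbolic : hyperbolic_group R G.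
Proof.
exists S, (3 * E + D + 6)%:R; split=> //; first by rewrite ler1n; lia.
move=> x y z A B C /geodesic_spans sA /geodesic_spans sB /geodesic_spans sC.
split; apply: thin_side; try eassumption; exact: spans_sym.
Qed.

End CayleyMetric.

(** * Conclusion *)

Lemma regular_hyperbolic (R : realType) (G : groupType) (S : {fset G})
    (hS : generates S) (lambda : R) : 3 < lambda ->
  regular [set w : seq (letters S) | quasigeodesic_word lambda 0 w]%classic ->
  hyperbolic_group R G.
Proof.
move=> l3 reg; have [M M0 ext] := regular_extend hS l3 reg.
have thinM : thin_triangles S (7 * M); last first.
  apply: (thin_triangles_hyperbolic R hS thinM) => n f g.
  exact: (thin_stable hS thinM).
move=> n m p f e c i; apply: (thin hS M0 _ ext).
  move=> w q3 u /infixP[s [t E]]; rewrite addr0.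
  apply: (@le_trans _ _ (3 * (word_dist S 1%g (word_val u))%:R)).
    by rewrite -natrM ler_nat (q3 s u t).
  by rewrite ler_wpM2r ?ler0n //; lra.
move=> w qw w1; have := qw w (infix_refl w).
by rewrite w1 word_distxx // mulr0 addr0 lern0 => /eqP/size0nil.
Qed.

Theorem theorem1p3 (R : realType) (G : groupType)
    (hfg : finitely_generated G) (hnh : ~ hyperbolic_group R G)
    (S : {fset G}) (hS : generates S) (lambda' : R) (hl : 54 < lambda') :
  ~ regular [set w : seq (letters S) | quasigeodesic_word lambda' 0 w]%classic.
Proof. by move=> reg; apply/hnh/(regular_hyperbolic hS _ reg); lra. Qed.
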